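(* Let $K\subset S^3$ be a knot of Jones period $p$. Let $a/b\in js_K\cup js_K^*$ be a Jones slope of $K$ (with $b>0$, $\gcd(a,b)=1$) and let $S$ be a corresponding Jones surface. Then $b$ divides $p^2$, and $b|\partial S|$ divides $2p^2\chi(S)$. In particular, if $p=1$ then all the Jones slopes of $K$ are integral and for every Jones surface $S$ of $K$ we have $\frac{2\chi(S)}{|\partial S|}\in\mathbb Z$.
   Context: Colored Jones polynomial. Define $S_0(x)=1$, $S_1(x)=x$, $S_{n+2}(x)=xS_{n+1}(x)-S_n(x)$. For a diagram $D$ of a knot $K$ let $D^m$ be the $m$-cable of $D$ with blackboard framing, and $\langle\cdot\rangle$ the Kauffman bracket (a Laurent polynomial in the variable $t^{-1/4}$, normalized by $\langle\text{unknot}\rangle=-(t^{1/2}+t^{-1/2})$), extended linearly to combinations of diagrams. $S_{n-1}(D)$ is the linear combination of cables obtained by replacing $x^m$ by $D^m$. With $w=w(D)$ the writhe, for $n>0$, $J_K(n):=\big((-1)^{n-1}t^{(n^2-1)/4}\big)^{w}(-1)^{n-1}\langle S_{n-1}(D)\rangle$. Let $d_+[J_K(n)]$, $d_-[J_K(n)]$ be its maximal and minimal degrees in $t$. Quasi-polynomiality (known, Garoufalidis). There is $n_K$ such that for all $n>n_K$, $d_+[J_K(n)]=a_K(n)n^2+b_K(n)n+c_K(n)$ and $d_-[J_K(n)]=a_K^*(n)n^2+b_K^*(n)n+c_K^*(n)$, where all six coefficients are periodic functions $\mathbb N\to\mathbb Q$ with integral period. The Jones period $p$ of $K$ is the least common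 multiple of the periods of all these coefficient functions. Let $\{x_n\}'$ denote the set of cluster points of a sequence. Set $js_K=\{4n^{-2}d_+[J_K(n)]\}'$, $js_K^*=\{4n^{-2}d_-[J_K(n)]\}'$ (their elements are the Jones slopes), $jx_K=\{2b_K(n)\}'$, $jx_K^*=\{2b_K^*(n)\}'$. Surfaces. $M_K=\overline{S^3\setminus n(K)}$ is the exterior of $K$, where $n(K)$ is a tubular neighborhood of $K$, and $\langle\mu,\lambda\rangle$ is the canonical meridian–longitude basis of $H_1(\partial n(K))$. A properly embedded surface $S\subset M_K$ is essential if it is $\pi_1$-injective and not a boundary parallel annulus. A boundary component has slope $a/b$ (with $\gcd(a,b)=1$) if it represents $\pm[a\mu+b\lambda]$. $|\partial S|$ is the number of boundary components (nonzero here). A Jones surface of $K$ corresponding to a Jones slope $a/b$ ($b>0$, $\gcd(a,b)=1$) is an essential surface $S\subset M_K$ all of whose boundary components have slope $a/b$ and such that either $a/b\in js_K$ and $\frac{\chi(S)}{|\partial S|b}\in jx_K$, or $a/b\in js_K^*$ and $-\frac{\chi(S)}{|\partial S|b}\in jx_K^*$. *)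

(* Defs.v *)
From mathcomp Require Import all_boot all_order all_algebra finmap.
From mathcomp Require Import all_classical all_reals all_analysis.

Set Implicit Arguments.
Unset Strict Implicit.
Unset Printing Implicit Defensive.

Import Order.TTheory GRing.Theory Num.Theory numFieldNormedType.Exports.

Local Open Scope classical_set_scope.
Local Open Scope ring_scope.

(** * Link diagrams and the Kauffman bracket *)

(* A link diagram is a planar 4-valent graph with crossings, up to isotopy of
   the plane. The four ends at a crossing are numbered 0, 1, 2, 3
   counterclockwise; 0 and 2 are the ends of the under-strand, 1 and 3 those of
   the over-strand. [joined] says that two ends belong to the same edge, and
   [circles] counts the closed components without crossings. *)
Record link_diagram := LinkDiagram {
  crossing : finType ;
  joined : rel (crossing * 'I_4) ;
  circles : nat }.

(* The A-smoothing connects 0-1 and 2-3, thus merging the two regions swept out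
   when the over-strand is rotated counterclockwise; the B-smoothing connects
   0-3 and 1-2. *)
Definition smoothed (isA : bool) (k l : 'I_4) : bool :=
  (if isA then k %/ 2 == l %/ 2
   else (k.+1 %% 4) %/ 2 == (l.+1 %% 4) %/ 2)%N.

Definition state (L : link_diagram) := {ffun crossing L -> bool}.

Definition state_rel (L : link_diagram) (s : state L) :
    rel (crossing L * 'I_4) :=
  fun x y => joined x y || (x.1 == y.1) && smoothed (s x.1) x.2 y.2.

Definition loops (L : link_diagram) (s : state L) : nat :=
  (n_comp (state_rel s) predT + circles L)%N.

Notation laurent := {fraction {poly int}}.

(* The variable of the bracket, A = t^(-1/4). *)
Definition varA : laurent := FracField.tofrac 'X.

Definition bracket (L : link_diagram) : laurent :=
  \sum_(s : state L)
    varA ^ (#|[pred x | s x]|%:Z - #|[pred x | ~~ s x]|%:Z)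
    * (- varA ^+ 2 - varA ^- 2) ^+ loops s.

(** * Cables *)

(* In the m-cable a crossing becomes an m by m grid of crossings (i, j), with i
   counted from the left and j from the bottom, when the crossing is drawn with
   the ends 0, 1, 2, 3 pointing down, right, up, left. The m outer ends on each
   of the four sides of the grid are numbered counterclockwise around it. *)
Section Cable.
Variables (L : link_diagram) (m : nat).

Definition cable_crossing : finType := (crossing L * ('I_m * 'I_m))%type.

Definition cable_outer (x : cable_crossing * 'I_4) : bool :=
  let: (_, (i, j), k) := x in
  match val k with
  | 0 => val j == 0%N
  | 1 => i.+1 == m
  | 2 => j.+1 == m
  | _ => val i == 0%N
  end.

Definition cable_outer_index (x : cable_crossing * 'I_4) : nat :=
  let: (_, (i, j), k) := x in
  match val k with
  | 0 => i
  | 1 => j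
  | 2 => (m.-1 - i)%N
  | _ => (m.-1 - j)%N
  end.

Definition cable_inner (x y : cable_crossing * 'I_4) : bool :=
  let: (c, (i, j), k) := x in let: (c', (i', j'), k') := y in
  ((c == c') &&
   ([&& val k == 1, val k' == 3, val i' == i.+1 & j' == j]
    || [&& val k == 2, val k' == 0, i' == i & val j' == j.+1]))%N.

(* The m parallel copies of an edge run in a flat band, so that the
   counterclockwise orders at its two ends are opposite. *)
Definition cable_joined : rel (cable_crossing * 'I_4) := fun x y =>
  [|| cable_inner x y, cable_inner y x
    | [&& cable_outer x, cable_outer y,
          @joined L (x.1.1, x.2) (y.1.1, y.2)
        & cable_outer_index x + cable_outer_index y == m.-1]]%N.

Definition cable : link_diagram :=
  @LinkDiagram cable_crossing cable_joined (m * circles L)%N.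

End Cable.

(** * Knot diagrams *)

(* An oriented knot diagram, as a signed Gauss code: the 2c passages through
   the c crossings are numbered cyclically along the knot, [passage (x, true)]
   being the over- and [passage (x, false)] the under-passage of x. *)
Record knot_diagram := KnotDiagram {
  ncross : nat ;
  passage : 'I_ncross * bool -> 'I_(ncross.*2) ;
  passage_inj : injective passage ;
  positive : 'I_ncross -> bool }.

Section KnotDiagram.
Variable D : knot_diagram.

(* End 0 is where the knot enters the under-strand. Hence it leaves the
   over-strand at end 1 of a positive crossing and at end 3 of a negative one. *)
Definition end_out (x : 'I_(ncross D) * 'I_4) : bool :=
  match val x.2 with
  | 0 => false
  | 1 => positive x.1
  | 2 => true
  | _ => ~~ positive x.1
  end.

Definition end_passage (x : 'I_(ncross D) * 'I_4) : 'I_((ncross D).*2) :=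
  passage (x.1, odd x.2).

Definition end_next (x y : 'I_(ncross D) * 'I_4) : bool :=
  [&& end_out x, ~~ end_out y
    & (end_passage x).+1 %% (ncross D).*2 == end_passage y]%N.

Definition underlying_link : link_diagram :=
  @LinkDiagram ('I_(ncross D)) (fun x y => end_next x y || end_next y x)
    (ncross D == 0)%N.

Definition writhe : int :=
  \sum_(x < ncross D) (if positive x then 1 else -1).

Fixpoint chebyshev_S (n : nat) : {poly int} :=
  match n with
  | 0 => 1
  | n'.+1 => if n' is n''.+1 then 'X * chebyshev_S n' - chebyshev_S n'' else 'X
  end.

Definition cable_bracket (P : {poly int}) : laurent :=
  \sum_(m < size P) (P`_m)%:~R * bracket (cable underlying_link m).

(* Recall that t^((n^2-1)/4) = A^(1-n^2). *)
Definition colored_jones (n : nat) : laurent :=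
  ((-1) ^+ n.-1 * varA ^ (1 - n%:Z ^+ 2)) ^ writhe
  * (-1) ^+ n.-1 * cable_bracket (chebyshev_S n.-1).

End KnotDiagram.

(* Extreme exponents of A in a nonzero Laurent polynomial. *)
Definition min_degA (f : laurent) : int :=
  xget 0 [set k : int | exists P : {poly int},
    P`_0 != 0 /\ f = FracField.tofrac P * varA ^ k].

Definition max_degA (f : laurent) : int :=
  xget 0 [set l : int | exists (P : {poly int}) (k : int),
    [/\ P != 0, f = FracField.tofrac P * varA ^ k & l = (size P).-1%:Z + k]].

(* As A = t^(-1/4), degrees in t are obtained on multiplying by -1/4. *)
Definition d_plus (D : knot_diagram) (n : nat) : rat :=
  - (min_degA (colored_jones D n))%:~R / 4.
Definition d_minus (D : knot_diagram) (n : nat) : rat :=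
  - (max_degA (colored_jones D n))%:~R / 4.

(** * Jones slopes and the Jones period *)

Definition is_period (f : nat -> rat) (q : nat) : Prop :=
  (0 < q)%N /\ forall n, f (n + q)%N = f n.

Definition least_period (f : nat -> rat) : nat :=
  xget 0%N [set q | is_period f q /\ forall q', is_period f q' -> (q <= q')%N].

Definition quasi_coefs (d a b c : nat -> rat) : Prop :=
  [/\ exists q, is_period a q, exists q, is_period b q,
      exists q, is_period c q
    & exists N : nat, forall n, (N < n)%N ->
        d n = a n * n%:R ^+ 2 + b n * n%:R + c n].

Definition jones_period (D : knot_diagram) (p : nat) : Prop :=
  exists a b c a' b' c' : nat -> rat,
    [/\ quasi_coefs (d_plus D) a b c, quasi_coefs (d_minus D) a' b' c'
      & p = foldr lcmn 1%N
          [seq least_period f | f <- [:: a; b; c; a'; b'; c']]].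

Section JonesSlopes.
Variable R : realType.

Definition slope_set (d : nat -> rat) : set R :=
  cluster ((fun n : nat => 4 * n%:R ^- 2 * ratr (d n) : R) @ \oo).

Definition linear_set (d : nat -> rat) : set R :=
  [set x | exists a b c : nat -> rat, quasi_coefs d a b c /\
    cluster ((fun n : nat => 2 * ratr (b n) : R) @ \oo) x].

Definition js (D : knot_diagram) : set R := slope_set (d_plus D).
Definition js_star (D : knot_diagram) : set R := slope_set (d_minus D).
Definition jx (D : knot_diagram) : set R := linear_set (d_plus D).
Definition jx_star (D : knot_diagram) : set R := linear_set (d_minus D).

End JonesSlopes.

Arguments js : clear implicits.
Arguments js_star : clear implicits.
Arguments jx : clear implicits.
Arguments jx_star : clear implicits.

(** * Knots in the 3-sphere and their diagrams *)

Definition S3 (R : realType) := one_point_compactification 'rV[R]_3.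

Section Knots.
Variable R : realType.

Definition xcoord (u : 'rV[R]_3) : R := u 0 (inord 0).
Definition ycoord (u : 'rV[R]_3) : R := u 0 (inord 1).
Definition zcoord (u : 'rV[R]_3) : R := u 0 (inord 2).

(* Position at time s, where 0 <= s < n, on the closed polygon with vertices
   v 0, ..., v (n - 1), the i-th edge being traversed for i <= s <= i + 1. *)
Definition edge_vec (n : nat) (v : nat -> 'rV[R]_3) (i : nat) : 'rV[R]_3 :=
  v (i.+1 %% n)%N - v (i %% n)%N.

Definition polygon (n : nat) (v : nat -> 'rV[R]_3) (s : R) : 'rV[R]_3 :=
  let i := Num.truncn s in v (i %% n)%N + (s - i%:R) *: edge_vec n v i.

Definition simple_polygon (n : nat) (v : nat -> 'rV[R]_3) : Prop :=
  (2 < n)%N /\ set_inj `[0, n%:R[ (polygon n v).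

Definition polygon_set (n : nat) (v : nat -> 'rV[R]_3) : set (S3 R) :=
  [set Some (polygon n v s) | s in `[0, n%:R[].

Definition ambient_isotopic (A B : set (S3 R)) : Prop :=
  exists H : R -> S3 R -> S3 R,
    [/\ {within `[0, 1] `*` setT, continuous (fun x => H x.1 x.2)},
        forall s, 0 <= s <= 1 -> bijective (H s),
        H 0 =1 id & H 1 @` A = B].

(* Tame knots, not oriented. *)
Definition is_knot (K : set (S3 R)) : Prop :=
  exists n v, simple_polygon n v /\ ambient_isotopic (polygon_set n v) K.

Definition shadow (u : 'rV[R]_3) : R * R := (xcoord u, ycoord u).

Definition cross (u v : 'rV[R]_3) : R :=
  xcoord u * ycoord v - ycoord u * xcoord v.

(* D is read off from the projection along the z-axis, seen from above; the
   passage with number i occurs at time tau i. The projection is regular: all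
   its multiple points are transverse double points away from the vertices. *)
Definition projects_to (n : nat) (v : nat -> 'rV[R]_3) (D : knot_diagram) :
    Prop :=
  exists tau : 'I_((ncross D).*2) -> R,
    let time x b := tau (passage (x, b)) in
    let dir x b := edge_vec n v (Num.truncn (time x b)) in
    [/\ forall i j : 'I_((ncross D).*2), (i < j)%N -> tau i < tau j,
        forall i, 0 < tau i < n%:R /\ tau i \isn't a Num.int,
        forall s t, 0 <= s < n%:R -> 0 <= t < n%:R -> s != t ->
          shadow (polygon n v s) = shadow (polygon n v t) <->
          exists x b, s = time x b /\ t = time x (~~ b),
        forall x, zcoord (polygon n v (time x false))
                  < zcoord (polygon n v (time x true))
      & forall x, cross (dir x true) (dir x false) != 0 /\
          positive x = (0 < cross (dir x true) (dir x false))].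

Definition diagram_of (D : knot_diagram) (K : set (S3 R)) : Prop :=
  exists n v, [/\ simple_polygon n v, projects_to n v D
                & ambient_isotopic (polygon_set n v) K].

(** * Tubular neighbourhoods and knot exteriors *)

Definition circle : set (R * R) := [set x | x.1 ^+ 2 + x.2 ^+ 2 = 1].
Definition disc (r : R) : set (R * R) :=
  [set x | x.1 ^+ 2 + x.2 ^+ 2 <= r ^+ 2].
Definition ball3 : set 'rV[R]_3 := [set u : 'rV[R]_3 | \sum_i u 0 i ^+ 2 <= 1].
Definition open_ball3 : set 'rV[R]_3 := [set u : 'rV[R]_3 | \sum_i u 0 i ^+ 2 < 1].

(* An embedding of the closed ball in S^3 preserves the orientations iff it is
   isotopic, through embeddings, to the inclusion of the unit ball of R^3. *)
Definition preserves_orientation (f : 'rV[R]_3 -> S3 R) : Prop :=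
  exists F : R -> 'rV[R]_3 -> S3 R,
    [/\ {within `[0, 1] `*` ball3, continuous (fun x => F x.1 x.2)},
        forall s, 0 <= s <= 1 -> set_inj ball3 (F s),
        forall u, ball3 u -> F 0 u = f u
      & forall u, ball3 u -> F 1 u = Some u].

(* An orientation preserving embedding of S^1 x D^2 with core K. It is defined
   on a disc of radius 2, so that the boundary of the tube of radius 1 is
   collared. *)
Definition tubular_neighbourhood (K : set (S3 R))
    (T : (R * R) * (R * R) -> S3 R) : Prop :=
  [/\ {within circle `*` disc 2, continuous T},
      set_inj (circle `*` disc 2) T,
      T @` (circle `*` [set (0, 0)]) = K
    & preserves_orientation (fun u =>
        T ((cos (xcoord u), sin (xcoord u)), (ycoord u, zcoord u)))].

Definition tube (T : (R * R) * (R * R) -> S3 R) : set (S3 R) :=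
  T @` (circle `*` disc 1).
Definition tube_boundary (T : (R * R) * (R * R) -> S3 R) : set (S3 R) :=
  T @` (circle `*` circle).
Definition exterior (T : (R * R) * (R * R) -> S3 R) : set (S3 R) :=
  closure (~` tube T).

End Knots.

(** * Singular 1-homology *)

Section Homology.
Variables (R : realType) (U : topologicalType).

(* Singular chains as formal sums; of a singular 1-simplex, only the values on
   [0, 1] matter. *)
Definition chain_coef (c : seq (int * (R -> U))) (f : R -> U) : int :=
  \sum_(x <- c | `[< forall t, 0 <= t <= 1 -> x.2 t = f t >]) x.1.

Definition triangle : set (R * R) :=
  [set x | [/\ 0 <= x.1, 0 <= x.2 & x.1 + x.2 <= 1]].

Definition simplex2_in (X : set U) (f : R * R -> U) : Prop :=
  {within triangle, continuous f} /\ f @` triangle `<=` X.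

Definition chain_boundary (d : seq (int * (R * R -> U))) :
    seq (int * (R -> U)) :=
  flatten [seq [:: (x.1, fun t => x.2 (1 - t, t));
                   (- x.1, fun t => x.2 (0, t));
                   (x.1, fun t => x.2 (t, 0))] | x <- d].

Definition null_homologous (X : set U) (c : seq (int * (R -> U))) : Prop :=
  exists d : seq (int * (R * R -> U)),
    all (fun x => `[< simplex2_in X x.2 >]) d /\
    forall f, chain_coef (chain_boundary d) f = chain_coef c f.

(** * Loops and homotopy *)

Definition loop_in (X : set U) (g : R -> U) : Prop :=
  [/\ {within `[0, 1], continuous g}, g 0 = g 1 & g @` `[0, 1] `<=` X].

Definition loop_homotopic (X : set U) (g h : R -> U) : Prop :=
  exists H : R * R -> U,
    [/\ {within `[0, 1] `*` `[0, 1], continuous H},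
        H @` (`[0, 1] `*` `[0, 1]) `<=` X,
        forall t, 0 <= t <= 1 -> H (0, t) = g t /\ H (1, t) = h t
      & forall s, 0 <= s <= 1 -> H (s, 0) = g 0 /\ H (s, 1) = g 0].

Definition pi1_injective (S M : set U) : Prop :=
  forall g h, loop_in S g -> loop_in S h -> g 0 = h 0 ->
    loop_homotopic M g h -> loop_homotopic S g h.

End Homology.

(** * Euler characteristic *)

Section Euler.
Variables (R : realType) (U : topologicalType).

Definition simplicial_complex (n : nat) (F : {set {set 'I_n}}) : Prop :=
  finset.set0 \notin F /\
  forall s t : {set 'I_n},
    s \in F -> t != finset.set0 -> t \subset s -> t \in F.

Definition realization (n : nat) (F : {set {set 'I_n}}) : set 'rV[R]_n :=
  [set u : 'rV[R]_n | [/\ forall i, 0 <= u 0 i, \sum_i u 0 i = 1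
             & exists2 s, s \in F & forall i, i \notin s -> u 0 i = 0]].

(* [f] is a homeomorphism onto S when U is a Hausdorff space, as the source is
   compact. *)
Definition euler_char (S : set U) : int :=
  xget 0 [set chi : int | exists n (F : {set {set 'I_n}}) (f : 'rV[R]_n -> U),
    [/\ simplicial_complex F, {within realization F, continuous f},
        set_inj (realization F) f, f @` realization F = S
      & chi = \sum_(s in F) (-1) ^+ #|s|.-1]].

End Euler.

(** * Essential surfaces, boundary slopes and Jones surfaces *)

Section Surfaces.
Variables (R : realType) (T : (R * R) * (R * R) -> S3 R).

Let M : set (S3 R) := exterior T.
Let dM : set (S3 R) := tube_boundary T.

Definition is_chart_at (f : 'rV[R]_3 -> S3 R) (x : S3 R) : Prop :=
  [/\ {within @ball3 R, continuous f}, set_inj (@ball3 R) f,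
      open (f @` @open_ball3 R) & f 0 = x].

(* Compact surfaces, connected or not, orientable or not, embedded in a locally
   flat way in M, with S meeting the boundary of M exactly in its own. *)
Definition properly_embedded (S : set (S3 R)) : Prop :=
  [/\ compact S, S `<=` M
    & forall x, S x -> exists f, is_chart_at f x /\
        let B := f @` @open_ball3 R in
        let plane := [set u | zcoord u = 0] in
        let half := [set u | 0 <= ycoord u] in
        (B `<=` M /\ S `&` B = f @` (@open_ball3 R `&` plane)) \/
        (M `&` B = f @` (@open_ball3 R `&` half) /\
         S `&` B = f @` (@open_ball3 R `&` (plane `&` half)))].

Definition boundary_parallel_annulus (S : set (S3 R)) : Prop :=
  exists P : (R * R) * R * R -> S3 R,
    let annulus := @circle R `*` `[0, 1] in
    [/\ {within annulus `*` `[0, 1], continuous P},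
        set_inj (annulus `*` `[0, 1]) P,
        P @` (annulus `*` `[0, 1]) `<=` M,
        P @` (annulus `*` [set 0]) = S
      & P @` (annulus `*` [set 1]) `<=` dM /\
        P @` ((@circle R `*` [set 0; 1]) `*` `[0, 1]) `<=` dM].

Definition essential (S : set (S3 R)) : Prop :=
  [/\ properly_embedded S, pi1_injective R S M
    & ~ boundary_parallel_annulus S].

Definition boundary_components (S : set (S3 R)) : set (set (S3 R)) :=
  [set connected_component (S `&` dM) x | x in S `&` dM].

Definition nboundary (S : set (S3 R)) : nat :=
  #|` fset_set (boundary_components S)|.

Definition unit_point (t : R) : R * R := (cos (2 * pi * t), sin (2 * pi * t)).

(* The curve on the boundary of the tube winding a times in the direction of the
   meridian and b times along the core. *)
Definition torus_curve (a b : int) (t : R) : S3 R :=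
  T (unit_point (b%:~R * t), unit_point (a%:~R * t)).

Definition meridian : R -> S3 R := torus_curve 1 0.

Definition is_longitude (l : R -> S3 R) : Prop :=
  exists k, l = torus_curve k 1 /\ null_homologous M [:: (1, l)].

Definition has_slope (C : set (S3 R)) (a b : int) : Prop :=
  exists g l, [/\ loop_in C g, set_inj `[0, 1[ g, g @` `[0, 1] = C,
    is_longitude l
    & null_homologous dM [:: (1, g); (- a, meridian); (- b, l)] \/
      null_homologous dM [:: (1, g); (a, meridian); (b, l)]].

Definition jones_surface (D : knot_diagram) (S : set (S3 R))
    (a : int) (b : nat) : Prop :=
  let slope : R := a%:~R / b%:R in
  let ratio : R := (euler_char R S)%:~R / ((nboundary S)%:R * b%:R) in
  [/\ essential S, (0 < nboundary S)%N,
      forall C, boundary_components S C -> has_slope C a b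
    & (js R D slope /\ jx R D ratio) \/
      (js_star R D slope /\ jx_star R D (- ratio))].

End Surfaces.

(* Main.v *)
Require Import Defs.
From mathcomp Require Import all_boot all_order all_algebra.
From mathcomp Require Import all_classical all_reals all_analysis.
From mathcomp Require Import ring lra zify.

Import Order.TTheory GRing.Theory Num.Theory numFieldNormedType.Exports.
Local Open Scope classical_set_scope.
Local Open Scope ring_scope.

Set Implicit Arguments.
Unset Strict Implicit.

(** The arithmetic behind the statement is that [2 d_plus D n] and
[2 d_minus D n] are integers, that is, that only even powers of A occur in the
colored Jones polynomial; integrality of the degrees in the variable A alone
would give the weaker bound 2 p^2 for the denominators of the slopes.

Evenness is a parity count on the state sum. A state of the m-cable of a diagram
with c crossings contributes A to a power congruent to c m^2 modulo 2, times a
polynomial in A^2 and A^(-2). Only cables with m congruent to n - 1 occur in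
S_(n-1), and the writhe w is congruent to c, so the framing factor A^((1-n^2) w)
turns every exponent into one congruent to c (1 - n^2 + m^2), which is even
([even_cable_bracket], [even_colored_jones]).

Write d(n) = a(n) n^2 + b(n) n + c(n) for large n, with coefficients of period p.
The second difference of d with step p is 2 a(n) p^2, and the first difference is
a(n) (2 n p + p^2) + b(n) p. As 2 d has integral values, so have 4 a(n) p^2 and then
4 b(n) p^2 ([quasi_coefs_integrality]).

The lower order terms of d(n) / n^2 tend to 0, and a periodic sequence takes
finitely many values, so that each Jones slope is some 4 a(n), and each element of
jx is some 2 b(n) ([slope_set_value], [linear_set_value]). Hence p^2 clears the
denominator of a slope a/b, and 2 p^2 that of the ratio of the Euler
characteristic to b times the number of boundary components, which are the two
divisibilities. *)

(** * Laurent polynomials in the square of the variable *)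

(** Stated with a composition so that closure under ring operations comes from
the substitution of X^2 being a ring morphism. *)
Definition even_laurent (f : laurent) : Prop :=
  exists (N : nat) (P : {poly int}),
    f * varA ^+ (2 * N) = FracField.tofrac (P \Po 'X^2).

Lemma varA_neq0 : varA != 0.
Proof. by rewrite /varA tofrac_eq0 polyX_eq0. Qed.

Lemma even_laurent_poly (P : {poly int}) :
  even_laurent (FracField.tofrac (P \Po 'X^2)).
Proof. by exists 0%N, P; rewrite mulr1. Qed.

Lemma tofracX2n (M : nat) :
  varA ^+ (2 * M) = FracField.tofrac ('X^M \Po 'X^2).
Proof. by rewrite comp_Xn_poly -exprM /varA tofracXn. Qed.

Lemma even_laurentD f g :
  even_laurent f -> even_laurent g -> even_laurent (f + g).
Proof.
move=> [N [P fP]] [M [Q gQ]]; exists (N + M)%N, (P * 'X^M + Q * 'X^N).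
rewrite comp_polyD !comp_polyM tofracD !tofracM.
by rewrite -!tofracX2n -fP -gQ mulnDr exprD; ring.
Qed.

Lemma even_laurentM f g :
  even_laurent f -> even_laurent g -> even_laurent (f * g).
Proof.
move=> [N [P fP]] [M [Q gQ]]; exists (N + M)%N, (P * Q).
by rewrite comp_polyM tofracM -fP -gQ mulnDr exprD; ring.
Qed.

Lemma even_laurent_int (z : int) : even_laurent z%:~R.
Proof.
have := even_laurent_poly z%:~R.
by rewrite !rmorph_int.
Qed.

Lemma even_laurentN f : even_laurent f -> even_laurent (- f).
Proof.
by rewrite -mulN1r; apply: even_laurentM; exact: (even_laurent_int (-1)).
Qed.

Lemma even_laurentX f n : even_laurent f -> even_laurent (f ^+ n).
Proof.
move=> ef; elim: n => [|n IHn]; first exact: (even_laurent_int 1).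
by rewrite exprS; apply: even_laurentM.
Qed.

Lemma even_laurent_varA (k : int) : (2 %| k)%Z -> even_laurent (varA ^ k).
Proof.
case/dvdzP=> j ->.
have -> : varA ^ (j * 2) = (varA ^+ 2) ^ j.
  by rewrite mulrC -exprz_exp.
case: j => n.
  rewrite -exprnP; apply: even_laurentX.
  by rewrite -[2%N]/(2 * 1)%N tofracX2n; exact: even_laurent_poly.
exists n.+1, 1; rewrite comp_polyC tofrac1 NegzE -exprnN.
by rewrite exprM mulVf // expf_neq0 // expf_neq0 // varA_neq0.
Qed.

Lemma even_laurent_sum (I : Type) (r : seq I) (Q : pred I) (F : I -> laurent) :
  (forall i, Q i -> even_laurent (F i)) ->
  even_laurent (\sum_(i <- r | Q i) F i).
Proof.
move=> eF; apply: (big_ind even_laurent) => //.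
- exact: (even_laurent_int 0).
- exact: even_laurentD.
Qed.

(** This covers both extreme degrees: the lowest one is read off at i = 0, the
highest one at the index of the leading coefficient. *)
Lemma even_laurent_exponent (P : {poly int}) (k : int) (i : nat) :
  even_laurent (FracField.tofrac P * varA ^ k) -> P`_i != 0 ->
  (2 %| i%:Z + k)%Z.
Proof.
move=> [N [Q PQ]] Pi0.
(* After clearing the negative power of A, both sides are polynomials and their
   coefficients can be compared. *)
have [k1 [k2 kE]] : exists k1 k2 : nat, k = k1%:Z - k2%:Z.
  by case: k {PQ} => n; [exists n, 0%N; rewrite subr0
                         | exists 0%N, n.+1; rewrite NegzE sub0r].
have : P * 'X^(k1 + 2 * N) = (Q \Po 'X^2) * 'X^k2.
  apply/eqP; rewrite -tofrac_eq !tofracM !tofracXn.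
  rewrite -PQ -/varA kE expfzDr ?varA_neq0 // -exprnN exprD -exprnP.
  rewrite -!mulrA; apply/eqP; do 2 congr (_ * _).
  by rewrite mulrCA mulVf ?mulr1 // expf_neq0 // varA_neq0.
move/(congr1 (fun R : {poly int} => R`_(i + (k1 + 2 * N)))).
rewrite coefMXn ltnNge leq_addl /= addnK => PiE.
move: Pi0; rewrite PiE coefMXn; case: ltnP => // le_k2.
rewrite coef_comp_poly_Xn //; case: ifP => // even_i _.
by rewrite kE; lia.
Qed.

Lemma even_min_degA f : even_laurent f -> (2 %| min_degA f)%Z.
Proof.
rewrite /min_degA; case: xgetP => // k _ [P [P0 ->]] ef.
by have := even_laurent_exponent ef P0; rewrite add0r.
Qed.

Lemma even_max_degA f : even_laurent f -> (2 %| max_degA f)%Z.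
Proof.
rewrite /max_degA; case: xgetP => // l _ [P [k [P0 -> ->]]] ef.
by apply: even_laurent_exponent ef _; rewrite -lead_coefE lead_coef_eq0.
Qed.

(** * Parity of the exponents of the colored Jones polynomial *)

Lemma writhe_parity (D : knot_diagram) : (2 %| writhe D - (ncross D)%:Z)%Z.
Proof.
have -> : (ncross D)%:Z = \sum_(x < ncross D) 1.
  by rewrite sumr_const card_ord natz.
by rewrite /writhe -sumrB; apply: rpred_sum => x _; case: ifP.
Qed.

Lemma chebyshev_S_parity n m : (chebyshev_S n)`_m != 0 -> odd m = odd n.
Proof.
elim/ltn_ind: n m => -[|[|n]] IHn m.
- by rewrite /= coef1; case: m.
- by rewrite /= coefX; case: m => [|[|m]].
rewrite -[chebyshev_S _]/('X * chebyshev_S n.+1 - chebyshev_S n) coefB coefXM.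
have [Sn0|Snm _] := eqVneq (chebyshev_S n)`_m 0.
  rewrite Sn0 subr0; case: m {Sn0} => [|m]; first by rewrite eqxx.
  by move/(IHn _ (ltnSn _)) => /= ->.
by rewrite (IHn _ _ m Snm) ?ltnS //= negbK.
Qed.

Lemma card_cable_crossing (D : knot_diagram) (m : nat) :
  #|crossing (cable (underlying_link D) m)| = (ncross D * (m * m))%N.
Proof. by rewrite /= !card_prod !card_ord. Qed.

(** The exponent of A coming from a state is #A - #B = c m^2 - 2 #B, and the writhe
is c modulo 2, so that the total exponent has the parity of c (1 - n^2 + m^2). *)
Lemma even_cable_bracket (D : knot_diagram) (n m : nat) :
  odd n != odd m ->
  even_laurent (varA ^ ((1 - n%:Z ^+ 2) * writhe D) *
                bracket (cable (underlying_link D) m)).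
Proof.
move=> nm; rewrite /bracket mulr_sumr; apply: even_laurent_sum => s _.
rewrite mulrA -expfzDr ?varA_neq0 //; apply: even_laurentM; last first.
  apply/even_laurentX/even_laurentD; apply: even_laurentN.
    exact: (@even_laurent_varA 2).
  by rewrite exprnN; apply: even_laurent_varA.
apply: even_laurent_varA.
have := cardC [pred x | s x]; rewrite card_cable_crossing.
have -> : #|[predC [pred x | s x]]| = #|[pred x | ~~ s x]| by apply: eq_card.
have /dvdzP[w] := writhe_parity D.
set a := #|_|; set b := #|_|; set c := ncross D => wE abE.
have {wE} -> : writhe D = w * 2 + c%:Z by rewrite -wE subrK.
have -> : a%:Z = (c * (m * m))%N%:Z - b%:Z by rewrite -abE; lia.
(* With e the common parity of m and n - 1, evenness becomes a ring identity. *)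
have [e [n' [m' [-> ->]]]] : exists (e : bool) (n' m' : nat),
    n = (~~ e + n'.*2)%N /\ m = (e + m'.*2)%N.
  exists (odd m), n./2, m./2.
  have <- : odd n = ~~ odd m by move: nm; case: (odd n); case: (odd m).
  by rewrite !odd_double_half.
have -> : (c * ((e + m'.*2) * (e + m'.*2)))%N%:Z =
    c%:Z * (e%:Z + 2 * m'%:Z) ^+ 2.
  by rewrite expr2; lia.
have -> : (~~ e + n'.*2)%N%:Z = (~~ e)%:Z + 2 * n'%:Z by lia.
apply/dvdzP; case: e {abE nm} => /=.
  exists ((1 - 4 * n'%:Z ^+ 2) * w + c%:Z * (1 - 2 * n'%:Z ^+ 2
          + 2 * m'%:Z + 2 * m'%:Z ^+ 2) - b%:Z).
  by ring.
exists ((1 - (1 + 2 * n'%:Z) ^+ 2) * w + c%:Z * (- 2 * n'%:Z - 2 * n'%:Z ^+ 2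
        + 2 * m'%:Z ^+ 2) - b%:Z).
by ring.
Qed.

(** At n = 0 the truncated predecessor selects S_0 = 1, and what remains is, up to
sign, the framing factor A^w, which is odd when the writhe w is. *)
Lemma even_colored_jones (D : knot_diagram) (n : nat) :
  (0 < n)%N -> even_laurent (colored_jones D n).
Proof.
case: n => // n _.
rewrite /colored_jones /= exprzMl ?unitfE ?expf_neq0 ?oppr_eq0 ?oner_eq0 //; last first.
  by rewrite expfz_neq0 // varA_neq0.
rewrite exprz_exp -!mulrA.
have sgn k : even_laurent ((-1) ^+ k).
  exact/even_laurentX/(even_laurent_int (-1)).
have sgnz k (z : int) : even_laurent (((-1) ^+ k) ^ z).
  case: z => j; first by rewrite -exprnP; exact: even_laurentX.
  by rewrite NegzE -exprnN -exprVn invr_sign; exact: even_laurentX.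
apply: even_laurentM => //; rewrite mulrCA; apply: even_laurentM => //.
rewrite /cable_bracket mulr_sumr; apply: even_laurent_sum => m _.
have [->|/chebyshev_S_parity mE] := eqVneq (chebyshev_S n)`_m 0.
  by rewrite mul0r mulr0; apply: (even_laurent_int 0).
rewrite mulrCA; apply: even_laurentM; first exact: even_laurent_int.
by apply: even_cable_bracket; rewrite /= mE; case: odd.
Qed.

(** * Periodic functions and the least period *)

Lemma is_period_addMn (f : nat -> rat) q n k :
  is_period f q -> f (n + k * q)%N = f n.
Proof.
case=> _ fq; elim: k => [|k IHk]; first by rewrite addn0.
by rewrite mulSn addnCA addnC fq.
Qed.

Lemma is_period_dvd (f : nat -> rat) q r :
  is_period f q -> (0 < r)%N -> (q %| r)%N -> is_period f r.
Proof.
by move=> fq r_gt0 /dvdnP[k rE]; split=> // n; rewrite rE; exact: is_period_addMn.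
Qed.

Lemma least_periodP (f : nat -> rat) :
  (exists q, is_period f q) -> is_period f (least_period f).
Proof.
move=> exq.
have exb : exists q, `[< is_period f q >] by case: exq => q ?; exists q; apply/asboolP.
rewrite /least_period; case: xgetP => [q _ []//|none].
case: (ex_minnP exb) => q /asboolP fq qmin; exfalso; apply: (none q).
by split=> // q' fq'; apply/qmin/asboolP.
Qed.

Lemma is_period_foldr_lcmn (f : nat -> rat) (s : seq (nat -> rat)) :
  (forall g, List.In g s -> exists q, is_period g q) -> List.In f s ->
  is_period f (foldr lcmn 1%N [seq least_period g | g <- s]).
Proof.
move=> pers fs.
have lcm_gt0 : (0 < foldr lcmn 1%N [seq least_period g | g <- s])%N.
  elim: s pers {fs} => //= g s IHs pers; rewrite lcmn_gt0 IHs; last first.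
    by move=> h hs; apply: pers; right.
  by rewrite andbT; case: (least_periodP (pers g (or_introl erefl))).
apply: (is_period_dvd (least_periodP (pers f fs)) lcm_gt0).
elim: s fs {pers lcm_gt0} => //= g s IHs [->|/IHs fs]; first exact: dvdn_lcml.
exact: dvdn_trans fs (dvdn_lcmr _ _).
Qed.

(** * Finite differences of quadratic quasi-polynomials *)

(** Along an arithmetic progression whose step is a common period the coefficients
are constant, so these are the differences of an ordinary quadratic polynomial. *)
Lemma quasi_differences (d a b c : nat -> rat) q :
  quasi_coefs d a b c -> is_period a q -> is_period b q -> is_period c q ->
  exists N : nat, forall m, (N < m)%N ->
    d (m + q + q)%N - 2 * d (m + q)%N + d m = 2 * a m * q%:R ^+ 2 /\
    d (m + q)%N - d m = a m * (2 * m%:R * q%:R + q%:R ^+ 2) + b m * q%:R.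
Proof.
move=> [_ _ _ [N dE]] [_ aq] [_ bq] [_ cq]; exists N => m Nm.
rewrite !dE ?ltn_addr // !aq !bq !cq !natrD.
by split; ring.
Qed.

(** The coefficients are recovered from the finite differences whose step is a
common period of both systems. This allows the linear coefficients in the
definition of jx to be taken independently of those that define the Jones
period. *)
Lemma quasi_coefs_linear_unique (d a b c a' b' c' : nat -> rat) :
  quasi_coefs d a b c -> quasi_coefs d a' b' c' -> b =1 b'.
Proof.
move=> dE dE'.
have [pa pb pc _] := dE; have [pa' pb' pc' _] := dE'.
pose s := [:: a; b; c; a'; b'; c'].
pose q := foldr lcmn 1%N [seq least_period g | g <- s].
have per f : List.In f s -> is_period f q.
  apply: is_period_foldr_lcmn => g /=.
  by do 6?[case=> [<-|] //].
have [Pa Pb Pc Pa' [Pb' Pc']] : [/\ is_period a q, is_period b q, is_period c q,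
    is_period a' q & is_period b' q /\ is_period c' q].
  by split; last split; apply: per; rewrite /=; do 6?[by left|right].
have [N dN] := quasi_differences dE Pa Pb Pc.
have [N' dN'] := quasi_differences dE' Pa' Pb' Pc'.
move=> n.
(* A translation by a multiple of the period moves n into the range where both
   expressions of d hold. *)
rewrite -(is_period_addMn n (maxn N N').+1 Pb).
rewrite -(is_period_addMn n (maxn N N').+1 Pb').
set m := (n + _)%N.
have q_gt0 : (0 < q)%N by case: Pa.
have mN : (maxn N N' < m)%N.
  by apply: leq_trans (leq_addl _ _); rewrite leq_pmulr.
have q_neq0 : (q%:R : rat) != 0 by rewrite pnatr_eq0 -lt0n.
have [|a2 a1] := dN m; first exact: leq_ltn_trans (leq_maxl _ _) mN.
have [|a2' a1'] := dN' m; first exact: leq_ltn_trans (leq_maxr _ _) mN.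
have aa' : a m = a' m.
  move: a2; rewrite a2' => /(mulIf (expf_neq0 2 q_neq0)).
  by move/(mulfI (_ : 2 != 0 :> rat)) => ->.
by move: a1; rewrite a1' aa' => /addrI /(mulIf q_neq0).
Qed.

(** The integer 4 a p^2 is the second difference of 2 d with step p. Substituting
it in 2 p times the first difference of 2 d leaves 4 b p^2. *)
Lemma quasi_coefs_integrality (d a b c : nat -> rat) p :
  (forall n, (0 < n)%N -> 2 * d n \is a Num.int) ->
  quasi_coefs d a b c -> is_period a p -> is_period b p -> is_period c p ->
  forall n, 4 * a n * p%:R ^+ 2 \is a Num.int /\
            4 * b n * p%:R ^+ 2 \is a Num.int.
Proof.
move=> dint dE Pa Pb Pc n.
have [N dN] := quasi_differences dE Pa Pb Pc.
rewrite -(is_period_addMn n N.+1 Pa) -(is_period_addMn n N.+1 Pb).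
set m := (n + _)%N.
have p_gt0 : (0 < p)%N by case: Pa.
have mN : (N < m)%N by apply: leq_trans (leq_addl _ _); rewrite leq_pmulr.
have [d2 d1] := dN m mN.
have i0 : 2 * d m \is a Num.int by apply: dint; case: (m) mN.
have i1 : 2 * d (m + p)%N \is a Num.int.
  by apply: dint; rewrite addn_gt0 p_gt0 orbT.
have i2 : 2 * d (m + p + p)%N \is a Num.int.
  by apply: dint; rewrite addn_gt0 p_gt0 orbT.
have ia : 4 * a m * p%:R ^+ 2 \is a Num.int.
  have -> : 4 * a m * p%:R ^+ 2
      = 2 * d (m + p + p)%N - 2 * (2 * d (m + p)%N) + 2 * d m by lra.
  by apply/rpredD/i0/rpredB => //; apply: rpredM => //; exact: natr_int.
split=> //.
have -> : 4 * b m * p%:R ^+ 2 = 2 * p%:R * (2 * d (m + p)%N - 2 * d m)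
      - 4 * a m * p%:R ^+ 2 * (2 * m%:R + p%:R).
  by rewrite -mulrBr d1; ring.
apply: rpredB; apply: rpredM => //.
- by rewrite -natrM natr_int.
- by apply: rpredB.
- by rewrite -natrM -natrD natr_int.
Qed.

(** * Cluster points of almost periodic sequences *)

Lemma cluster_asymptotic (R : realType) (u v : nat -> R) (x : R) :
  (fun n => u n - v n) @ \oo --> (0 : R) -> cluster (u @ \oo) x ->
  cluster (v @ \oo) x.
Proof.
move=> uv0 /cluster_eventuallyP ux; apply/cluster_eventuallyP => e n e_gt0.
have e2 : 0 < e / 2 by rewrite divr_gt0.
have [N _ uvN] := (cvgr0Pnorm_lt _).1 uv0 _ e2.
have [j nj uj] := ux (e / 2) (maxn n N) e2.
exists j; first exact: leq_trans (leq_maxl _ _) nj.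
have := uvN j (leq_trans (leq_maxr _ _) nj) => /= uvj.
rewrite (_ : x - v j = (x - u j) + (u j - v j)); last by ring.
by rewrite (le_trans (ler_normD _ _)) // (splitr e) lerD // ltW.
Qed.

(** A finite set is closed, so it contains the cluster points of its sequences. *)
Lemma cluster_finite_range (R : realType) (v : nat -> R) (x : R) :
  finite_set (range v) -> cluster (v @ \oo) x -> exists n, x = v n.
Proof.
move=> fin vx; suff [n _ <-] : range v x by exists n.
have : closed (range v).
  by apply: (accessible_finite_set_closed.1 _ _ fin); apply: hausdorff_accessible.
apply=> B Bx; apply: vx Bx.
by exists 0%N => // n _; exists n.
Qed.

Lemma periodic_finite_range (T : Type) (f : nat -> rat) (g : rat -> T) q :
  is_period f q -> finite_set (range (g \o f)).
Proof.
move=> fq; apply: (@sub_finite_set _ _ ((g \o f) @` `I_q)).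
  move=> _ [n _ <-]; exists (n %% q)%N => /=.
    by rewrite ltn_mod; case: fq.
  by rewrite [in RHS](divn_eq n q) addnC is_period_addMn.
exact/finite_image/finite_II.
Qed.

Lemma periodic_bounded (f : nat -> rat) q :
  is_period f q -> exists M : rat, forall n, `|f n| <= M.
Proof.
move=> fq; have q_gt0 : (0 < q)%N by case: fq.
exists (\sum_(i < q) `|f i|) => n.
have nq : (n %% q < q)%N by rewrite ltn_mod.
rewrite [in leLHS](divn_eq n q) addnC is_period_addMn //.
by rewrite (bigD1 (Ordinal nq)) //= lerDl sumr_ge0.
Qed.

(** The difference is 4 (b(n) + c(n) / n) / n, with b and c bounded since they are
periodic. *)
Lemma quasi_leading_cvg (R : realType) (d a b c : nat -> rat) :
  quasi_coefs d a b c ->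
  (fun n => 4 * n%:R ^- 2 * ratr (d n) - 4 * ratr (a n) : R) @ \oo --> (0 : R).
Proof.
move=> [_ [qb /periodic_bounded[Mb bM]] [qc /periodic_bounded[Mc cM]] [N dE]].
apply/cvgr0Pnorm_lt => e e_gt0; near=> n.
have n_gt0 : (0 < n)%N by near: n; exact: nbhs_infty_gt.
have n1 : 1 <= n%:R :> R by rewrite ler1n.
have nN : (N < n)%N by near: n; exact: nbhs_infty_gt.
have nneq0 : n%:R != 0 :> R by rewrite pnatr_eq0 -lt0n.
rewrite dE // !rmorphD !rmorphM /= !ratr_nat.
set B := ratr (b n); set C := ratr (c n) : R.
have -> : 4 * n%:R ^- 2 * (ratr (a n) * (n%:R * n%:R) + B * n%:R + C) - 4 * ratr (a n)
   = 4 * (B + C / n%:R) / n%:R by field.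
rewrite normrM normfV [X in _ / X]ger0_norm // ltr_pdivrMr ?ltr0n //.
have BM : `|B| <= ratr Mb by rewrite /B -ratr_norm ler_rat.
have CM : `|C| <= ratr Mc by rewrite /C -ratr_norm ler_rat.
have CnM : `|C / n%:R| <= ratr Mc.
  rewrite normrM normfV [X in _ / X]ger0_norm // ler_pdivrMr ?ltr0n //.
  by apply: (le_trans CM); rewrite ler_peMr // (le_trans _ CM).
rewrite -ltr_pdivrMl // (@le_lt_trans _ _ (e^-1 * (4 * (ratr Mb + ratr Mc)))) //.
  rewrite ler_pM2l ?invr_gt0 // normrM ger0_norm // ler_pM2l //.
  by rewrite (le_trans (ler_normD _ _)) // lerD.
by near: n; exact: nbhs_infty_gtr.
Unshelve. all: by end_near. Qed.

Lemma slope_set_value (R : realType) (d a b c : nat -> rat) (x : R) :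
  quasi_coefs d a b c -> slope_set d x -> exists n, x = ratr (4 * a n).
Proof.
move=> dE dx; have [[q Pa] _ _ _] := dE.
have /cluster_finite_range[|n ->] := cluster_asymptotic (quasi_leading_cvg dE) dx.
  exact: (periodic_finite_range (fun y => 4 * ratr y) Pa).
by exists n; rewrite rmorphM /= ratr_nat.
Qed.

Lemma linear_set_value (R : realType) (d a b c : nat -> rat) (x : R) :
  quasi_coefs d a b c -> linear_set d x -> exists n, x = ratr (2 * b n).
Proof.
move=> dE [a' [b' [c' [dE' bx]]]]; have [_ [q Pb'] _ _] := dE'.
have /cluster_finite_range[|n ->] := bx.
  exact: (periodic_finite_range (fun y => 2 * ratr y) Pb').
exists n; rewrite (quasi_coefs_linear_unique dE dE').
by rewrite rmorphM /= ratr_nat.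
Qed.

(** * Integrality of Jones slopes and of Euler characteristics *)

(** The degree in t is -1/4 of the degree in A, which is even. *)
Lemma half_integral_degrees (D : knot_diagram) (n : nat) :
  (0 < n)%N -> 2 * d_plus D n \is a Num.int /\ 2 * d_minus D n \is a Num.int.
Proof.
move=> /(even_colored_jones D) eJ; rewrite /d_plus /d_minus.
have half k : (2 %| k)%Z -> 2 * (- k%:~R / 4 : rat) \is a Num.int.
  case/dvdzP=> j ->; rewrite intrM.
  have -> : 2 * (- (j%:~R * 2%:~R) / 4) = - j%:~R :> rat by field.
  by rewrite rpredN intr_int.
by split; apply: half; [exact: even_min_degA|exact: even_max_degA].
Qed.

Lemma ratr_is_int (R : realType) (y : rat) :
  y \is a Num.int -> (ratr y : R) \is a Num.int.
Proof. by case/intrP=> m ->; rewrite ratr_int intr_int. Qed.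

Lemma quasi_cluster_integral (R : realType) (d a b c : nat -> rat) p :
  (forall n, (0 < n)%N -> 2 * d n \is a Num.int) ->
  quasi_coefs d a b c -> is_period a p -> is_period b p -> is_period c p ->
  (forall x : R, slope_set d x -> x * p%:R ^+ 2 \is a Num.int) /\
  (forall x : R, linear_set d x -> 2 * x * p%:R ^+ 2 \is a Num.int).
Proof.
move=> dint dE Pa Pb Pc.
have int_ab := quasi_coefs_integrality dint dE Pa Pb Pc.
have p2 : (p%:R ^+ 2 : R) = ratr (p%:R ^+ 2) by rewrite rmorphXn /= ratr_nat.
split=> x.
  case/(slope_set_value dE)=> n ->; rewrite p2 -rmorphM.
  by apply: ratr_is_int; case: (int_ab n).
case/(linear_set_value dE)=> n ->; rewrite p2 -[2](ratr_nat R 2) -!rmorphM.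
by rewrite mulrA -natrM; apply: ratr_is_int; case: (int_ab n).
Qed.

Lemma jones_cluster_integral (R : realType) (D : knot_diagram) (p : nat) :
  jones_period D p ->
  (forall x : R, (js R D `|` js_star R D) x -> x * p%:R ^+ 2 \is a Num.int) /\
  (forall x : R, (jx R D `|` jx_star R D) x -> 2 * x * p%:R ^+ 2 \is a Num.int).
Proof.
move=> [a [b [c [a' [b' [c' [dE dE' pE]]]]]]].
have [pa pb pc _] := dE; have [pa' pb' pc' _] := dE'.
have per f : List.In f [:: a; b; c; a'; b'; c'] -> is_period f p.
  rewrite pE; apply: is_period_foldr_lcmn => g /=.
  by do 6?[case=> [<-|] //].
have [||||sl li] := @quasi_cluster_integral R _ _ _ _ p _ dE.
- by move=> n /(half_integral_degrees D)[].
- by apply: per; rewrite /=; do 6?[by left|right].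
- by apply: per; rewrite /=; do 6?[by left|right].
- by apply: per; rewrite /=; do 6?[by left|right].
have [||||sl' li'] := @quasi_cluster_integral R _ _ _ _ p _ dE'.
- by move=> n /(half_integral_degrees D)[].
- by apply: per; rewrite /=; do 6?[by left|right].
- by apply: per; rewrite /=; do 6?[by left|right].
- by apply: per; rewrite /=; do 6?[by left|right].
by split=> x []; [exact: sl|exact: sl'|exact: li|exact: li'].
Qed.

Lemma int_ratio_dvd (R : realType) (u : int) (v : nat) :
  (0 < v)%N -> (u%:~R / v%:R : R) \is a Num.int -> (v%:Z %| u)%Z.
Proof.
move=> v_gt0 /intrP[m uE]; apply/dvdzP; exists m.
apply: (@intr_inj R); rewrite intrM -uE.
by rewrite mulfVK // pnatr_eq0 -lt0n.
Qed.

Unset Implicit Arguments.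

Theorem proposition3p1 (R : realType) (K : set (S3 R)) (hK : is_knot K)
    (D : knot_diagram) (hD : diagram_of D K)
    (T : (R * R) * (R * R) -> S3 R) (hT : tubular_neighbourhood K T)
    (p : nat) (hp : jones_period D p) :
  (forall (a : int) (b : nat), (0 < b)%N -> coprimez a b%:Z ->
     (js R D `|` js_star R D) (a%:~R / b%:R) ->
     (b %| p ^ 2)%N /\
     forall S : set (S3 R), jones_surface T D S a b ->
       ((b * nboundary T S)%N%:Z %| 2 * p%:Z ^+ 2 * euler_char R S)%Z) /\
  (p = 1%N ->
     (forall x : R, (js R D `|` js_star R D) x -> x \is a Num.int) /\
     (forall (S : set (S3 R)) (a : int) (b : nat),
        (0 < b)%N -> coprimez a b%:Z -> jones_surface T D S a b ->
        2 * (euler_char R S)%:~R / (nboundary T S)%:R \is a @Num.int R)).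
Proof.
have [slope_int linear_int] := jones_cluster_integral R hp.
have denominator_dvd (a : int) (b : nat) : (0 < b)%N -> coprimez a b%:Z ->
    (js R D `|` js_star R D) (a%:~R / b%:R) -> (b %| p ^ 2)%N.
  move=> b_gt0 co_ab /slope_int ab_int.
  have : (b%:Z %| a * (p ^ 2)%N%:Z)%Z.
    apply: (@int_ratio_dvd R) => //.
    by rewrite intrM -pmulrn natrX mulrAC.
  by rewrite Gauss_dvdzr // coprimez_sym.
have euler_dvd (a : int) (b : nat) (S : set (S3 R)) : (0 < b)%N ->
    jones_surface T D S a b ->
    ((b * nboundary T S)%N%:Z %| 2 * p%:Z ^+ 2 * euler_char R S)%Z.
  move=> b_gt0 [_ n_gt0 _ ratio].
  have ratio_int : 2 * ((euler_char R S)%:~R / ((nboundary T S)%:R * b%:R))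
      * p%:R ^+ 2 \is a @Num.int R.
    case: ratio => -[_ rx]; first by apply: linear_int; left.
    rewrite -rpredN -mulNr -mulrN; apply: linear_int; right; exact: rx.
  apply: (@int_ratio_dvd R); first by rewrite muln_gt0 b_gt0.
  rewrite (_ : _ / _ = 2 * ((euler_char R S)%:~R / ((nboundary T S)%:R * b%:R))
      * p%:R ^+ 2) //.
  rewrite natrM !intrM -!pmulrn; field.
  by rewrite !pnatr_eq0 -!lt0n b_gt0.
split=> [a b b_gt0 co_ab slope|p1].
  by split; [exact: denominator_dvd slope | move=> S; exact: euler_dvd].
split=> [x /slope_int|S a b b_gt0 co_ab JS]; first by rewrite p1 expr1n mulr1.
have b1 : b = 1%N.
  apply/eqP; rewrite -dvdn1; suff : (b %| p ^ 2)%N by rewrite p1.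
  apply: denominator_dvd b_gt0 co_ab _.
  by case: JS => _ _ _ [[? _]|[? _]]; [left|right].
have n_gt0 : (0 < nboundary T S)%N by case: JS.
have /dvdzP[m] := euler_dvd _ _ _ b_gt0 JS.
rewrite p1 b1 mul1n mulr1 => /(congr1 (intr : int -> R)).
rewrite !intrM => chiE; apply/intrP; exists m.
by rewrite chiE mulfK // pnatr_eq0 -lt0n.
Qed.
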